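(* Let $0<\mu<L$, let $f:\mathbb{R}^d\to\mathbb{R}$ be $L$-smooth and $\mu$-strongly convex, put $g=-\nabla f$ and $\beta=\frac{1-\sqrt{\mu/L}}{1+\sqrt{\mu/L}}$. Let $(x_k)_{k\ge 0}$ be a sequence in $\mathbb{R}^d$ generated by Polyak's heavy ball method $$x_{k+2}=x_{k+1}-c_1\nabla f(x_{k+1})+c_2(x_{k+1}-x_k),\qquad k\ge 0,\qquad c_1=\frac{1-\beta^2}{\sqrt{\mu L}},\quad c_2=\beta^2.$$ Then $(x_k)$ is generated by the explicit linear two-step method $(\rho,\sigma)$ with step size $h$, where $$\rho(z)=\beta^2-(1+\beta^2)z+z^2,\qquad \sigma(z)=(1-\beta^2)z,\qquad h=\frac{1}{\sqrt{\mu L}};$$ that is, $\rho(E)x_k=h\,\sigma(E)g(x_k)$ for every $k\ge 0$. Moreover $(\rho,\sigma)$ satisfies the consistency conditions $\rho(1)=0$ and $\rho'(1)=\sigma(1)$, and, for this $\rho$ and the given product polynomial $h\sigma(z)=\frac{1-\beta^2}{\sqrt{\mu L}}z$, this value of $h$ is the only step size for which the consistency conditions hold.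
   Context: $L$-smooth means $\nabla f$ is $L$-Lipschitz for the Euclidean norm. $\mu$-strongly convex means $\mu\|x-y\|^2\le\langle x-y,\nabla f(x)-\nabla f(y)\rangle$ for all $x,y$. The shift operator $E$ acts on sequences by $Ex_k=x_{k+1}$ and $Eg(x_k)=g(x_{k+1})$, so for a polynomial $p(z)=\sum_i p_i z^i$ one has $p(E)x_k=\sum_i p_i x_{k+i}$ and $p(E)g(x_k)=\sum_i p_i g(x_{k+i})$. A linear $s$-step method $(\rho,\sigma)$, with $\rho$ monic of degree $s$ and $\sigma$ with coefficients $\sigma_0,\dots,\sigma_s$, integrates the ODE $\dot x=g(x)$ with step size $h$ by generating sequences with $\rho(E)x_k=h\sigma(E)g(x_k)$ for all $k\ge0$; it is explicit if $\sigma_s=0$. *)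

(* Defs.v *)
From mathcomp Require Import all_boot all_order all_algebra.
From mathcomp Require Import all_classical all_reals all_analysis.

Set Implicit Arguments.
Unset Strict Implicit.
Unset Printing Implicit Defensive.

Import Order.TTheory GRing.Theory Num.Theory.
Import numFieldNormedType.Exports.

Local Open Scope ring_scope.

Definition dot (R : realType) (d : nat) (u v : 'rV[R]_d) : R :=
  \sum_(i < d) u 0 i * v 0 i.

(* The norm `|u| that 'rV[R]_d carries by default is the sup norm, so the
   Euclidean norm has to be introduced separately.  Both induce the same
   topology, hence the same notion of differentiability. *)
Definition enorm (R : realType) (d : nat) (u : 'rV[R]_d) : R :=
  Num.sqrt (dot u u).

(* The vector of partial derivatives; it is the gradient at the points where
   f is differentiable. *)
Definition grad (R : realType) (d : nat) (f : 'rV[R]_d -> R)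
    (x : 'rV[R]_d) : 'rV[R]_d :=
  \row_(i < d) 'D_(delta_mx 0 i : 'rV[R]_d) f x.

Definition smooth (R : realType) (d : nat) (L : R) (f : 'rV[R]_d -> R) : Prop :=
  (forall x, differentiable f x) /\
  (forall x y, enorm (grad f x - grad f y) <= L * enorm (x - y)).

Definition strongly_convex (R : realType) (d : nat) (mu : R)
    (f : 'rV[R]_d -> R) : Prop :=
  (forall x, differentiable f x) /\
  (forall x y, mu * enorm (x - y) ^+ 2 <= dot (x - y) (grad f x - grad f y)).

Definition heavy_ball (R : realType) (d : nat) (f : 'rV[R]_d -> R)
    (c1 c2 : R) (x : nat -> 'rV[R]_d) : Prop :=
  forall k : nat,
    x k.+2 = x k.+1 - c1 *: grad f (x k.+1) + c2 *: (x k.+1 - x k).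

(* p(E) u at index k, where E is the shift operator (E u) k = u (k + 1). *)
Definition shift_poly (R : realType) (d : nat) (p : {poly R})
    (u : nat -> 'rV[R]_d) (k : nat) : 'rV[R]_d :=
  \sum_(i < size p) p`_i *: u (k + i)%N.

Definition linear_multistep (R : realType) (s : nat)
    (rho sigma : {poly R}) : Prop :=
  [/\ rho \is monic, size rho = s.+1 & (size sigma <= s.+1)%N].

Definition explicit_method (R : realType) (s : nat) (sigma : {poly R}) : Prop :=
  sigma`_s = 0.

Definition generated_by (R : realType) (d : nat) (rho sigma : {poly R}) (h : R)
    (g : 'rV[R]_d -> 'rV[R]_d) (x : nat -> 'rV[R]_d) : Prop :=
  forall k : nat,
    shift_poly rho x k = h *: shift_poly sigma (fun i => g (x i)) k.

Definition consistent (R : realType) (rho sigma : {poly R}) : Prop :=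
  rho.[1] = 0 /\ (rho^`()).[1] = sigma.[1].

(* Main.v *)
Require Import Defs.
From mathcomp Require Import all_boot all_order all_algebra.
From mathcomp Require Import all_classical all_reals all_analysis.
From mathcomp Require Import ring lra.

Import Order.TTheory GRing.Theory Num.Theory.
Import numFieldNormedType.Exports.

Local Open Scope ring_scope.

(** Collecting the iterates of the heavy ball recursion on one side gives coefficients $\beta^2$,
    $-(1+\beta^2)$, $1$ on $x_k$, $x_{k+1}$, $x_{k+2}$, which are those of $\rho$; what remains is
    $-c_1\nabla f(x_{k+1}) = h(1-\beta^2)g(x_{k+1})$. Consistency is evaluation at $1$. For
    uniqueness, [step_size_unique] shows that consistency fixes the step size once the product
    polynomial is given, provided $\rho'(1) = 1-\beta^2$ is nonzero; this follows from
    [heavy_ball_momentum_bounds]. *)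

(** Padding with zero coefficients lets $\rho$ and $\sigma$, whose sizes differ, be expanded over
    the same indices. *)
Lemma shift_poly_widen (R : realType) (d n : nat) (p : {poly R})
    (u : nat -> 'rV[R]_d) (k : nat) :
  (size p <= n)%N -> shift_poly p u k = \sum_(i < n) p`_i *: u (k + i)%N.
Proof.
move=> le_pn; rewrite /shift_poly.
rewrite (big_ord_widen _ (fun i => p`_i *: u (k + i)%N) le_pn) big_mkcond.
by apply: eq_bigr => i _; case: ltnP => // /(nth_default 0) ->; rewrite scale0r.
Qed.

Lemma heavy_ball_momentum_bounds (R : realType) (mu L : R) :
  0 < mu -> mu < L ->
  0 < (1 - Num.sqrt (mu / L)) / (1 + Num.sqrt (mu / L)) < 1.
Proof.
move=> mu_gt0 mu_ltL; have L_gt0 := lt_trans mu_gt0 mu_ltL.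
have s_gt0 : 0 < Num.sqrt (mu / L) by rewrite sqrtr_gt0 divr_gt0.
have s_lt1 : Num.sqrt (mu / L) < 1.
  by rewrite -[ltRHS]sqrtr1 ltr_sqrt // ltr_pdivrMr // mul1r.
have D_gt0 : 0 < 1 + Num.sqrt (mu / L) by lra.
by apply/andP; split; [rewrite divr_gt0 // | rewrite ltr_pdivrMr //]; lra.
Qed.

(** Evaluating the product polynomial at $1$ gives $\tau(1) = h\sigma(1) = h\rho'(1)$, so the
    unknown $\sigma$ drops out. *)
Lemma step_size_unique (R : realType) (rho sigma tau : {poly R}) (h : R) :
  rho^`().[1] != 0 -> consistent rho sigma -> h *: sigma = tau ->
  h = tau.[1] / rho^`().[1].
Proof.
by move=> rho'1 [_ rho'E] <-; rewrite hornerZ -rho'E mulfK.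
Qed.

Theorem mainTheorem2 (R : realType) (d : nat) (mu L : R)
    (f : 'rV[R]_d -> R) (x : nat -> 'rV[R]_d) :
  0 < mu -> mu < L ->
  smooth L f -> strongly_convex mu f ->
  let g : 'rV[R]_d -> 'rV[R]_d := fun y => - grad f y in
  let beta : R := (1 - Num.sqrt (mu / L)) / (1 + Num.sqrt (mu / L)) in
  let c1 : R := (1 - beta ^+ 2) / Num.sqrt (mu * L) in
  let c2 : R := beta ^+ 2 in
  heavy_ball f c1 c2 x ->
  let rho : {poly R} := (beta ^+ 2)%:P - (1 + beta ^+ 2) *: 'X + 'X^2 in
  let sigma : {poly R} := (1 - beta ^+ 2) *: 'X in
  let h : R := 1 / Num.sqrt (mu * L) in
  let hsigma : {poly R} := ((1 - beta ^+ 2) / Num.sqrt (mu * L)) *: 'X in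
  [/\ linear_multistep 2 rho sigma /\ explicit_method 2 sigma,
      generated_by rho sigma h g x,
      consistent rho sigma,
      h *: sigma = hsigma
    & forall (h' : R) (sigma' : {poly R}),
        h' *: sigma' = hsigma -> consistent rho sigma' -> h' = h].
Proof.
move=> mu_gt0 mu_ltL _ _ g beta c1 c2 hb rho sigma h hsigma.
have /andP[b_gt0 b_lt1] : 0 < beta < 1 :=
  heavy_ball_momentum_bounds _ _ _ mu_gt0 mu_ltL.
(* This number is $\rho'(1)$, the divisor in the uniqueness argument. *)
have b2_neq0 : 1 - beta ^+ 2 != 0.
  by rewrite subr_eq0 eq_sym lt_eqF // expr_lt1 // ltW.
have rhoC i : rho`_i = beta ^+ 2 * (i == 0)%N%:R
    - (1 + beta ^+ 2) * (i == 1)%N%:R + (i == 2)%N%:R.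
  by rewrite /rho !coefE; case: (i == 0)%N => /=; ring.
have sigmaC i : sigma`_i = (1 - beta ^+ 2) * (i == 1)%N%:R.
  by rewrite /sigma !coefE.
(* The lower-order part cannot affect the leading term, so ['X^2] alone fixes the size of [rho]. *)
have size_lin : (size ((beta ^+ 2)%:P - (1 + beta ^+ 2) *: 'X)%R < 3)%N.
  by apply/leq_sizeP => -[|[|j]] // _; rewrite !coefE /=; ring.
have size_rho : size rho = 3%N by rewrite /rho addrC size_polyDl size_polyXn.
have size_sigma : (size sigma <= 3)%N.
  by apply: leq_trans (size_scale_leq _ _) _; rewrite size_polyX.
have rho1 : rho.[1] = 0 by rewrite /rho !hornerE; ring.
have rho'1 : rho^`().[1] = 1 - beta ^+ 2.
  by rewrite /rho !poly.derivE !hornerE /=; ring.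
split.
- split; last by rewrite /explicit_method sigmaC mulr0.
  by split; rewrite // monicE lead_coefE size_rho rhoC /= mulr1n; apply/eqP; ring.
- move=> k; rewrite !(@shift_poly_widen _ _ 3%N) ?size_rho //.
  rewrite !big_ord_recl !big_ord0 !rhoC !sigmaC /= !addn0 addn1 addn2 hb.
  (* With $x_{k+2}$ replaced by the recursion, both sides reduce in each coordinate to $-c_1\nabla
     f(x_{k+1})$. *)
  rewrite /g /c1 /c2 /h; apply/rowP => j; rewrite !mxE.
  ring.
- by split; rewrite // rho'1 /sigma !hornerE.
- by rewrite /hsigma /sigma /h scalerA div1r [_^-1 * _]mulrC.
- move=> h' sigma' hE cons; rewrite (step_size_unique _ _ _ _ _ _ cons hE) rho'1 //.
  (* The factor $1-\beta^2$ cancels, leaving $1/\sqrt{\mu L}$. *)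
  by rewrite /hsigma /h !hornerE mulrAC divff ?div1r.
Qed.
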